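(* Let $\{\lambda^n/\mu^n\}_{n\ge0}$ be a graded skew partition sequence and for each $n\geq0$ put $u_n=h_{\lambda^n/\mu^n}$ and $m=|\lambda^n|-n$. Then the set $\{u_n\}_{n\geq0}$ is algebraically independent over $\mathbb Z$ and generates $\Lambda_{\mathbb{Z}}$ as a $\mathbb Z$-algebra if and only if, for each $n\geq 1$, $\lambda_1^n\geq n$ and $(\lambda^n,\mu^n)$ satisfies one of the following conditions: (1) $\mu^n=(m)$ and $\lambda_2^n<n$; (2) $\lambda^n=(n,m)$ with $m<n$, and $\mu^n$ is any partition of $m$; (3) $\lambda^n=(n+m)$, and $\mu^n$ is any partition of $m$.
   Context: $\Lambda_{\mathbb Z}$ is the ring of symmetric functions in infinitely many variables with integer coefficients, $h_\lambda=\prod_i h_{\lambda_i}$ the complete homogeneous symmetric functions, and the Hall inner product satisfies $\langle h_\lambda,m_\mu\rangle=\delta_{\lambda\mu}$. A skew partition of $n$ is any pair $(\lambda,\mu)$ of partitions with $|\lambda|-|\mu|=n$, written $\lambda/\mu$ (containment not assumed); a graded skew partition sequence has $\lambda^n/\mu^n$ a skew partition of $n$ for each $n$. The skew complete function is defined by $\langle h_{\lambda/\mu},f\rangle=\langle h_\lambda,h_\mu f\rangle$ for all $f$. $\lambda^n_1\ge\lambda^n_2\ge\cdots$ are the parts of $\lambda^n$.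
   Formalization: Algebraic independence is asserted for the u_n with n ≥ 1 only, since u_0 is an integer constant and a set containing it is never algebraically independent (e.g. λ^n=(n), μ^n=∅ gives u_0=1); generation still uses all n ≥ 0. *)

(* Defs.v *)
From HB Require Import structures.
From mathcomp Require Import all_boot all_order all_algebra perm.
From mathcomp Require Import boolp.
From mathcomp Require Import mpoly.

Set Implicit Arguments.
Unset Strict Implicit.
Unset Printing Implicit Defensive.

Import GRing.Theory.
Local Open Scope ring_scope.

Definition is_intpart (s : seq nat) : bool := sorted geq s && all (leq 1) s.

Record intpart : Type :=
  IntPart { ipval :> seq nat; ipvalP : is_intpart ipval }.

HB.instance Definition _ := [isSub for ipval].
HB.instance Definition _ := [Equality of intpart by <:].

(* Parts are counted from 0: [part la 0] is lambda_1; the value is 0 past the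
   length. *)
Definition part (la : intpart) (i : nat) : nat := nth 0%N la i.

Definition psize (la : intpart) : nat := sumn la.

(* Allows writing partitions such as (n, m) with m possibly 0. *)
Definition nonzero (s : seq nat) : seq nat := [seq k <- s | (0 < k)%N].

(* The map x_1, ..., x_n, x_(n+1) |-> x_1, ..., x_n, 0. *)
Definition restrict_tuple (n : nat) : n.+1.-tuple {mpoly int[n]} :=
  [tuple if unlift ord_max i is Some j then 'X_j else 0 | i < n.+1].

Definition restrict (n : nat) (p : {mpoly int[n.+1]}) : {mpoly int[n]} :=
  p \mPo restrict_tuple n.

(* The ring of symmetric functions in infinitely many variables over the
   integers, as the inverse limit, in the category of graded rings, of the
   rings of symmetric polynomials in n variables. *)
Record symfun : Type := SymFun {
  sfpol :> forall n, {mpoly int[n]};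
  sfpol_sym : forall n, sfpol n \is symmetric;
  sfpol_restrict : forall n, restrict (sfpol n.+1) = sfpol n;
  sfpol_bounded : exists d, forall n, (msize (sfpol n) <= d)%N
}.

Lemma symfunP (f g : symfun) : (forall n, f n = g n) -> f = g.
Proof.
case: f g => [f f1 f2 f3] [g g1 g2 g3] /= fg.
have {}fg : f = g by apply: functional_extensionality_dep.
case: _ / fg in g1 g2 g3 *.
by congr SymFun; apply: Prop_irrelevance.
Qed.

HB.instance Definition _ := gen_eqMixin symfun.
HB.instance Definition _ := gen_choiceMixin symfun.

Section RingStructure.
Implicit Types f g : symfun.

Fact sf0_restrict n : restrict (0 : {mpoly int[n.+1]}) = 0.
Proof. exact: comp_mpoly0. Qed.

Fact sf0_bounded : exists d, forall n, (msize (0 : {mpoly int[n]}) <= d)%N.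
Proof. by exists 0%N => n; rewrite msize0. Qed.

Definition sf0 : symfun :=
  @SymFun (fun n => 0) (fun n => rpred0 _) sf0_restrict sf0_bounded.

Fact sf1_restrict n : restrict (1 : {mpoly int[n.+1]}) = 1.
Proof. exact: comp_mpoly1. Qed.

Fact sf1_bounded : exists d, forall n, (msize (1 : {mpoly int[n]}) <= d)%N.
Proof. by exists 1%N => n; rewrite msize1. Qed.

Definition sf1 : symfun :=
  @SymFun (fun n => 1) (fun n => rpred1 _) sf1_restrict sf1_bounded.

Fact sfN_sym f n : - f n \is symmetric.
Proof. by rewrite rpredN sfpol_sym. Qed.

Fact sfN_restrict f n : restrict (- f n.+1) = - f n.
Proof. by rewrite /restrict comp_mpolyN -/(restrict _) sfpol_restrict. Qed.

Fact sfN_bounded f : exists d, forall n, (msize (- f n) <= d)%N.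
Proof. by case: (sfpol_bounded f) => d df; exists d => n; rewrite msizeN. Qed.

Definition sfN f : symfun := SymFun (sfN_sym f) (sfN_restrict f) (sfN_bounded f).

Fact sfD_sym f g n : f n + g n \is symmetric.
Proof. by rewrite rpredD ?sfpol_sym. Qed.

Fact sfD_restrict f g n : restrict (f n.+1 + g n.+1) = f n + g n.
Proof. by rewrite /restrict comp_mpolyD -!/(restrict _) !sfpol_restrict. Qed.

Fact sfD_bounded f g : exists d, forall n, (msize (f n + g n) <= d)%N.
Proof.
have [[d df] [e eg]] := (sfpol_bounded f, sfpol_bounded g).
exists (maxn d e) => n; apply: leq_trans (msizeD_le _ _) _.
by rewrite geq_max !leq_max df eg orbT.
Qed.

Definition sfD f g : symfun :=
  SymFun (sfD_sym f g) (sfD_restrict f g) (sfD_bounded f g).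

Fact sfM_sym f g n : f n * g n \is symmetric.
Proof. by rewrite rpredM ?sfpol_sym. Qed.

Fact sfM_restrict f g n : restrict (f n.+1 * g n.+1) = f n * g n.
Proof. by rewrite /restrict rmorphM /= -!/(restrict _) !sfpol_restrict. Qed.

Fact sfM_bounded f g : exists d, forall n, (msize (f n * g n) <= d)%N.
Proof.
have [[d df] [e eg]] := (sfpol_bounded f, sfpol_bounded g).
exists (d + e)%N => n.
have [->|fn0] := eqVneq (f n) 0; first by rewrite mul0r msize0.
have [->|gn0] := eqVneq (g n) 0; first by rewrite mulr0 msize0.
rewrite msizeM // (leq_trans (leq_pred _)) //.
exact: leq_add.
Qed.

Definition sfM f g : symfun :=
  SymFun (sfM_sym f g) (sfM_restrict f g) (sfM_bounded f g).

Fact sfDA : associative sfD.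
Proof. by move=> f g h; apply: symfunP => n /=; rewrite addrA. Qed.
Fact sfDC : commutative sfD.
Proof. by move=> f g; apply: symfunP => n /=; rewrite addrC. Qed.
Fact sf0D : left_id sf0 sfD.
Proof. by move=> f; apply: symfunP => n /=; rewrite add0r. Qed.
Fact sfND : left_inverse sf0 sfN sfD.
Proof. by move=> f; apply: symfunP => n /=; rewrite addNr. Qed.

HB.instance Definition _ :=
  GRing.isZmodule.Build symfun sfDA sfDC sf0D sfND.

Fact sfMA : associative sfM.
Proof. by move=> f g h; apply: symfunP => n /=; rewrite mulrA. Qed.
Fact sfMC : commutative sfM.
Proof. by move=> f g; apply: symfunP => n /=; rewrite mulrC. Qed.
Fact sf1M : left_id sf1 sfM.
Proof. by move=> f; apply: symfunP => n /=; rewrite mul1r. Qed.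
Fact sfMDl : left_distributive sfM +%R.
Proof. by move=> f g h; apply: symfunP => n /=; rewrite mulrDl. Qed.
Fact sf1_neq0 : sf1 != 0.
Proof.
apply/eqP => /(congr1 (fun f : symfun => f 0%N)) /= /eqP.
by rewrite oner_eq0.
Qed.

HB.instance Definition _ :=
  GRing.Zmodule_isComNzRing.Build symfun sfMA sfMC sf1M sfMDl sf1_neq0.

End RingStructure.

Section Polynomials.
Variable n : nat.

Definition hpol (k : nat) : {mpoly int[n]} :=
  \sum_(a : 'X_{1..n < k.+1} | mdeg a == k) 'X_[a].

(* The sum of all distinct monomials whose exponents are the parts of [la],
   in some order. *)
Definition mpol (la : intpart) : {mpoly int[n]} :=
  \sum_(a : 'X_{1..n < (psize la).+1} | perm_eq (nonzero a) la) 'X_[a].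

Lemma mcoeff_sumX (d : nat) (P : pred 'X_{1..n}) (m : 'X_{1..n}) :
  (forall a, P a -> mdeg a < d)%N ->
  (\sum_(a : 'X_{1..n < d} | P a) 'X_[a] : {mpoly int[n]})@_m = (P m)%:R.
Proof.
move=> Pd; rewrite raddf_sum /=.
have [Pm|nPm] := boolP (P m); last first.
  rewrite big1 // => a Pa; rewrite mcoeffX; case: eqP => // am.
  by rewrite am (negPf nPm) in Pa.
rewrite (bigD1 (BMultinom (Pd _ Pm))) //= mcoeffX eqxx big1 ?addr0 // => a.
by case/andP=> _; rewrite mcoeffX bmeqP /= => /negPf ->.
Qed.

Lemma sumn_nonzero (s : seq nat) : sumn (nonzero s) = sumn s.
Proof. by elim: s => //= -[|k] s /= ->. Qed.

Lemma mdegEsumn (a : 'X_{1..n}) : mdeg a = sumn a.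
Proof. by rewrite mdegE sumnE big_tuple; apply: eq_bigr. Qed.

Lemma mcoeff_hpol (k : nat) (m : 'X_{1..n}) : (hpol k)@_m = (mdeg m == k)%:R.
Proof.
by rewrite /hpol (@mcoeff_sumX _ (fun a => mdeg a == k)) // => a /eqP ->.
Qed.

Lemma mcoeff_mpol (la : intpart) (m : 'X_{1..n}) :
  (mpol la)@_m = (perm_eq (nonzero m) la)%:R.
Proof.
rewrite /mpol (@mcoeff_sumX _ (fun a => perm_eq (nonzero a) la)) // => a.
by move=> /perm_sumn; rewrite sumn_nonzero mdegEsumn ltnS /psize => ->.
Qed.

Lemma msize_le (p : {mpoly int[n]}) (d : nat) :
  (forall m, p@_m != 0 -> mdeg m < d)%N -> (msize p <= d)%N.
Proof.
move=> pd; rewrite msizeE; apply/bigmax_leqP_seq => m mp _.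
by apply: pd; rewrite -mcoeff_msupp.
Qed.

End Polynomials.

Definition extend0 (n : nat) (m : 'X_{1..n}) : 'X_{1..n.+1} :=
  [multinom if unlift ord_max i is Some j then m j else 0%N | i < n.+1].

Lemma mcoeff_restrict (n : nat) (p : {mpoly int[n.+1]}) (m : 'X_{1..n}) :
  (restrict p)@_m = p@_(extend0 m).
Proof.
have eX (k : 'X_{1..n.+1}) :
    (restrict 'X_[k])@_m = ('X_[k] : {mpoly int[n.+1]})@_(extend0 m).
  rewrite /restrict comp_mpolyX big_ord_recr /= tnth_mktuple unlift_none.
  under eq_bigr => i _.
    have wi : widen_ord (leqnSn n) i = lift ord_max i.
      by apply: val_inj; exact: esym (lift_max i).
    rewrite wi tnth_mktuple liftK; over.
  rewrite expr0n mcoeffX; have [k0|k0] := eqVneq (k ord_max) 0%N.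
    rewrite mulr1.
    pose k' : 'X_{1..n} := [multinom k (lift ord_max i) | i < n].
    have -> : \prod_(i < n) 'X_i ^+ k (lift ord_max i) = 'X_[k'] :> {mpoly int[n]}.
      by rewrite mpolyXE_id; apply: eq_bigr => i _; rewrite mnmE.
    rewrite mcoeffX; congr (_%:R); congr nat_of_bool; apply/eqP/eqP => [<-|km].
      apply/mnmP => i; rewrite mnmE; case: unliftP => [j ->|->] //.
      by rewrite mnmE.
    by apply/mnmP => i; rewrite mnmE km mnmE liftK.
  rewrite mulr0 mcoeff0; case: eqP => // km; move: k0.
  by rewrite km mnmE unlift_none eqxx.
rewrite (mpolyE p) /restrict (raddf_sum (comp_mpoly _)) /= !raddf_sum /=.
apply: eq_bigr => k _.
by rewrite comp_mpolyZ !mcoeffZ -/(restrict _) eX.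
Qed.

Lemma nonzero_extend0 (n : nat) (m : 'X_{1..n}) :
  nonzero (extend0 m) = nonzero m.
Proof.
have -> : extend0 m = rcons m 0%N :> seq nat.
  apply: (@eq_from_nth _ 0%N) => [|i]; rewrite ?size_rcons !size_tuple // => lti.
  rewrite nth_rcons size_tuple -[i]/(val (Ordinal lti)) -tnth_nth.
  rewrite -[tnth _ _]/(extend0 m (Ordinal lti)) mnmE.
  case: unliftP => [j ->|->]; last by rewrite /= ltnn eqxx.
  by rewrite [val _]lift_max ltn_ord -tnth_nth.
by rewrite /nonzero filter_rcons.
Qed.

Lemma mdeg_extend0 (n : nat) (m : 'X_{1..n}) : mdeg (extend0 m) = mdeg m.
Proof. by rewrite !mdegEsumn -sumn_nonzero nonzero_extend0 sumn_nonzero. Qed.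

Section CompleteMonomial.

Fact hpol_sym (k n : nat) : hpol n k \is symmetric.
Proof.
by apply/issymP => s; apply/mpolyP => m; rewrite mcoeff_sym !mcoeff_hpol mdeg_mperm.
Qed.

Fact hpol_restrict (k n : nat) : restrict (hpol n.+1 k) = hpol n k.
Proof.
by apply/mpolyP => m; rewrite mcoeff_restrict !mcoeff_hpol mdeg_extend0.
Qed.

Fact hpol_bounded (k : nat) : exists d, forall n, (msize (hpol n k) <= d)%N.
Proof.
exists k.+1 => n; apply: msize_le => m; rewrite mcoeff_hpol.
by have [->|_] := eqVneq (mdeg m) k; rewrite ?eqxx.
Qed.

Definition sfh (k : nat) : symfun :=
  SymFun (hpol_sym k) (hpol_restrict k) (hpol_bounded k).

Definition sfhpart (la : intpart) : symfun := \prod_(k <- la) sfh k.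

Fact mpol_sym (la : intpart) (n : nat) : mpol n la \is symmetric.
Proof.
apply/issymP => s; apply/mpolyP => m; rewrite mcoeff_sym !mcoeff_mpol.
congr (_%:R); congr nat_of_bool; apply: permPl; apply: perm_filter.
by apply/tuple_permP; exists s.
Qed.

Fact mpol_restrict (la : intpart) (n : nat) : restrict (mpol n.+1 la) = mpol n la.
Proof.
by apply/mpolyP => m; rewrite mcoeff_restrict !mcoeff_mpol nonzero_extend0.
Qed.

Fact mpol_bounded (la : intpart) :
  exists d, forall n, (msize (mpol n la) <= d)%N.
Proof.
exists (psize la).+1 => n; apply: msize_le => m; rewrite mcoeff_mpol.
case: (boolP (perm_eq _ _)) => [/perm_sumn|_]; last by rewrite eqxx.
by rewrite sumn_nonzero mdegEsumn => ->.
Qed.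

Definition sfm (la : intpart) : symfun :=
  SymFun (mpol_sym la) (mpol_restrict la) (mpol_bounded la).

End CompleteMonomial.

(* As the h_la and the m_mu are bases, exactly one form satisfies this. *)
Record is_hall (form : symfun -> symfun -> int) : Prop := IsHall {
  hall_addl : forall g, {morph form^~ g : f1 f2 / f1 + f2};
  hall_addr : forall f, {morph form f : g1 g2 / g1 + g2};
  hall_dual : forall la mu, form (sfhpart la) (sfm mu) = (la == mu)%:R
}.

(* [u] is h_{la/mu} with respect to the form; no containment is assumed. *)
Definition is_skew_complete (form : symfun -> symfun -> int)
    (la mu : intpart) (u : symfun) : Prop :=
  forall f, form u f = form (sfhpart la) (sfhpart mu * f).

Definition graded_skew_sequence (la mu : nat -> intpart) : Prop :=
  forall n, psize (la n) = (psize (mu n) + n)%N.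

Section Generators.
Variable A : comNzRingType.
Implicit Type u : nat -> A.

Definition poly_eval u (N : nat) (p : {mpoly int[N]}) : A :=
  mmap intr (fun i : 'I_N => u i) p.

(* Finite subfamilies are contained in initial segments. *)
Definition alg_independent u : Prop :=
  forall (N : nat) (p : {mpoly int[N]}), poly_eval u p = 0 -> p = 0.

Definition alg_generates u : Prop :=
  forall x : A, exists (N : nat) (p : {mpoly int[N]}), x = poly_eval u p.

End Generators.

(* Main.v *)
(* The h_nu being dual to the m_nu, the coefficient of h_nu in h_{la/mu} is
   <h_{la/mu}, m_nu> = <h_la, h_mu m_nu>, the coefficient of x^la in h_mu m_nu.
   Hence u_n is homogeneous of degree n, and the family generates freely exactly
   when the coefficient of h_n in u_n is a unit for every n >= 1.  That
   coefficient is the sum, over the i with la_i >= n, of the number of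
   contingency tables with row sums mu and column sums la - n e_i.  Each such
   number is positive, and it is 1 only when mu has at most one part or
   la - n e_i has at most one nonzero entry. *)

From HB Require Import structures.
Require Import Defs.
From mathcomp Require Import all_boot all_order all_algebra perm.
From mathcomp Require Import boolp zify.
From mathcomp Require Import mpoly.

Section SkewComplete.
Set Implicit Arguments.
Unset Strict Implicit.
Import Order.TTheory GRing.Theory Num.Theory.
Local Open Scope ring_scope.

Implicit Types (la mu nu ka : intpart) (s : seq nat) (f g : symfun).

(** * Partitions *)

Lemma all_nonzero s : all (leq 1) (nonzero s).
Proof. exact: filter_all. Qed.

Lemma nonzero_id s : all (leq 1) s -> nonzero s = s.
Proof. by move/all_filterP. Qed.

Lemma intpart_all la : all (leq 1) la.
Proof. by case/andP: (ipvalP la). Qed.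

Lemma nonzero_intpart la : nonzero la = la.
Proof. exact/nonzero_id/intpart_all. Qed.

Lemma geq_anti : antisymmetric geq.
Proof. by move=> i j; rewrite /geq /= andbC -eqn_leq => /eqP. Qed.

Lemma geq_total : total geq.
Proof. by move=> i j; exact: leq_total. Qed.

Lemma geq_trans : transitive geq.
Proof. by move=> i j k ji kj; exact: leq_trans kj ji. Qed.

Lemma perm_intpart la mu : perm_eq la mu -> la = mu.
Proof.
case/andP: (ipvalP la) (ipvalP mu) => sla _ /andP[smu _] lamu.
exact/val_inj/(sorted_eq geq_trans geq_anti).
Qed.

Fact intpart_of_subproof s : is_intpart (sort geq (nonzero s)).
Proof.
rewrite /is_intpart all_sort all_nonzero andbT.
exact: sort_sorted geq_total _.
Qed.

Definition intpart_of s : intpart := IntPart (intpart_of_subproof s).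

Lemma perm_intpart_of s : perm_eq (intpart_of s) (nonzero s).
Proof. by rewrite /= perm_sort. Qed.

Lemma psize_intpart_of s : psize (intpart_of s) = sumn s.
Proof. by rewrite /psize (perm_sumn (perm_intpart_of s)) sumn_nonzero. Qed.

Lemma eq_intpart_of s la : perm_eq (nonzero s) la -> intpart_of s = la.
Proof. by move=> sla; apply/perm_intpart/(perm_trans (perm_intpart_of s)). Qed.

Lemma intpart_of_id la : intpart_of la = la.
Proof. by apply: eq_intpart_of; rewrite nonzero_intpart. Qed.

Lemma size_intpart la : (size la <= psize la)%N.
Proof.
have [_] := andP (ipvalP la); rewrite /psize.
elim: (ipval la) => //= k s IH /andP[k0 sP].
by rewrite -add1n leq_add ?IH.
Qed.

Lemma size_intpart_gt0 la : (0 < psize la)%N -> (0 < size la)%N.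
Proof. by rewrite /psize; case: (ipval la). Qed.

Lemma intpart_gt0 la k : k \in ipval la -> (0 < k)%N.
Proof. exact: (allP (intpart_all la)). Qed.

(* The partitions of size at most [D], as the sorted exponents of the monomials
   of degree at most [D] in [D] variables. *)
Definition parts (D : nat) : seq intpart :=
  undup [seq intpart_of a | a : 'X_{1..D < D.+1}].

Lemma parts_uniq D : uniq (parts D).
Proof. exact: undup_uniq. Qed.

Lemma mem_parts D la : (la \in parts D) = (psize la <= D)%N.
Proof.
rewrite mem_undup; apply/imageP/idP => [[a _ ->]|laD].
  by rewrite psize_intpart_of -mdegEsumn -ltnS bmdeg.
have szP : size (la ++ nseq (D - size la) 0%N) == D.
  by rewrite size_cat size_nseq subnKC // (leq_trans (size_intpart la)).
pose a : 'X_{1..D} := Multinom (Tuple szP).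
have a_la : nonzero a = la.
  rewrite /a /= /nonzero filter_cat -!/(nonzero _) nonzero_intpart.
  by rewrite /nonzero filter_nseq /= cats0.
have aD : (mdeg a < D.+1)%N.
  by rewrite mdegEsumn -sumn_nonzero a_la ltnS.
exists (BMultinom aD) => //; apply/esym/eq_intpart_of.
by rewrite -[X in perm_eq X _]/(nonzero a) a_la.
Qed.

Lemma count_nonzero0 s : count_mem 0%N s = (size s - size (nonzero s))%N.
Proof.
rewrite size_filter -(count_predC (fun k => 0 < k)%N s) addKn.
by apply: eq_count => k /=; rewrite lt0n negbK.
Qed.

Lemma perm_nonzero s t :
  size s = size t -> perm_eq (nonzero s) (nonzero t) -> perm_eq s t.
Proof.
move=> st nst; apply/allP => -[|k] _ /=.
  by rewrite !count_nonzero0 st (perm_size nst).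
move/seq.permP/(_ (pred1 k.+1)): nst; rewrite !count_filter.
by rewrite !(@eq_count _ (predI _ _) (pred1 k.+1)) => [->||] // [|j] //=;
  rewrite ?andbT ?andbF.
Qed.

(** * Expansion in the monomial basis *)

Lemma mcoeff_perm f (n : nat) (a b : 'X_{1..n}) :
  perm_eq a b -> (f n)@_a = (f n)@_b.
Proof.
move=> /tuple_permP[p ab].
rewrite -[X in X@_b](issymP _ (sfpol_sym f n) p) mcoeff_sym; congr (_ @__).
by apply/val_inj/val_inj; exact: ab.
Qed.

(** Trailing zeros can be appended one variable at a time by compatibility with restriction. Once
    the numbers of variables agree, the two exponent vectors are permutations of each other and
    symmetry applies. *)
Lemma mcoeff_nonzero f (n m : nat) (a : 'X_{1..n}) (b : 'X_{1..m}) :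
  perm_eq (nonzero a) (nonzero b) -> (f n)@_a = (f m)@_b.
Proof.
wlog le_nm : n m a b / (n <= m)%N => [H ab|].
  case/orP: (leq_total n m) => [|le_mn]; first by move/H; apply.
  by apply/esym/H => //; rewrite perm_sym.
(* The equation is kept as a hypothesis so that [n] can grow while [m] stays fixed during the
   induction on [k]. *)
have [k def_m] : {k | m = k + n}%N by exists (m - n)%N; rewrite subnK.
elim: k n a def_m {le_nm} => [|k IH] n a def_m ab.
  rewrite add0n in def_m; subst m; apply/mcoeff_perm/perm_nonzero => //.
  by rewrite !size_tuple.
rewrite -(sfpol_restrict f n) mcoeff_restrict; apply: IH.
  by rewrite def_m addnS.
by rewrite nonzero_extend0.
Qed.

Definition part_mnm la : 'X_{1..size la} := Multinom (in_tuple la).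

(** This is the coefficient of m_la in [f], read in the fewest variables in which the monomial x^la
    exists. *)
Definition coef f la : int := (f (size la))@_(part_mnm la).

Lemma mcoeffE f (n : nat) (a : 'X_{1..n}) la :
  perm_eq (nonzero a) la -> (f n)@_a = coef f la.
Proof. by move=> ala; apply: mcoeff_nonzero; rewrite /= nonzero_intpart. Qed.

Lemma eq_coef f g : coef f =1 coef g -> f = g.
Proof.
move=> fg; apply: symfunP => n; apply/mpolyP => a.
have ala : perm_eq (nonzero a) (intpart_of a).
  by rewrite perm_sym perm_intpart_of.
by rewrite !(mcoeffE _ ala).
Qed.

(** Additivity alone already gives linearity over the integers; this is what makes a merely
    biadditive form usable on expansions. *)
Lemma morph_sumMz (V : zmodType) (phi : V -> int) (I : Type) (r : seq I)
    (F : I -> V) (c : I -> int) : {morph phi : x y / x + y} ->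
  phi (\sum_(i <- r) F i *~ c i) = \sum_(i <- r) phi (F i) * c i.
Proof.
move=> phiD; have phiB : zmod_morphism phi.
  by move=> x y; apply/eqP; rewrite eq_sym subr_eq -phiD subrK.
pose psi : {additive V -> int} :=
  HB.pack phi (GRing.isZmodMorphism.Build _ _ phi phiB).
rewrite -[LHS]/(psi _) raddf_sum; apply: eq_bigr => i _.
by rewrite raddfMz -mulrzr intz.
Qed.

Lemma coef_sumMz (I : Type) (r : seq I) (F : I -> symfun) (c : I -> int) la :
  coef (\sum_(i <- r) F i *~ c i) la = \sum_(i <- r) coef (F i) la * c i.
Proof.
by apply: (morph_sumMz (phi := coef^~ la)) => f g; rewrite /coef /= mcoeffD.
Qed.

Lemma coef_sfm la mu : coef (sfm la) mu = (mu == la)%:R.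
Proof.
rewrite /coef /= mcoeff_mpol nonzero_intpart; congr _%:R; congr nat_of_bool.
by apply/idP/eqP => [/perm_intpart|->].
Qed.

Lemma sum_delta (T : eqType) (r : seq T) (F : T -> int) (x : T) : uniq r ->
  \sum_(y <- r) (x == y)%:R * F y = if x \in r then F x else 0.
Proof.
move=> r_uniq; case: ifP => [xr|/negP xr].
  rewrite (bigD1_seq x) //= eqxx mul1r big1 ?addr0 // => y.
  by rewrite eq_sym => /negPf->; rewrite mul0r.
rewrite big_seq big1 // => y yr; case: eqP => [xy|]; last by rewrite mul0r.
by rewrite xy in xr.
Qed.

Lemma coef_large f : exists D, forall la, coef f la != 0 -> (psize la <= D)%N.
Proof.
have [D fD] := sfpol_bounded f; exists D => la nz.
rewrite -[psize la]/(sumn (part_mnm la)) -mdegEsumn; apply: ltnW.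
by apply: leq_trans (fD (size la)); apply: msize_mdeg_lt; rewrite mcoeff_msupp.
Qed.

Lemma sfm_expand f (r : seq intpart) : uniq r ->
  (forall la, coef f la != 0 -> la \in r) ->
  f = \sum_(la <- r) sfm la *~ coef f la.
Proof.
move=> r_uniq fr; apply: eq_coef => la; rewrite coef_sumMz.
under eq_bigr do rewrite coef_sfm.
rewrite (@sum_delta _ r (coef f)) //; case: ifP => // /negbT.
by apply: contraNeq => /eqP ?; apply: fr; apply/eqP.
Qed.

Definition sf_homog (d : nat) f : Prop := forall n, f n \is d.-homog.

Lemma sf_homog_coef d f la : sf_homog d f -> coef f la != 0 -> psize la = d.
Proof.
move=> /(_ (size la))/dhomogP fd; rewrite /coef -mcoeff_msupp => /fd <-.
by rewrite [RHS]mdegEsumn.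
Qed.

Lemma sf_homogM d e f g :
  sf_homog d f -> sf_homog e g -> sf_homog (d + e) (f * g).
Proof. by move=> fd ge n; apply: dhomogM. Qed.

Lemma sf_homog_sfm la : sf_homog (psize la) (sfm la).
Proof.
move=> n; apply/dhomogP => a; rewrite mcoeff_msupp /= mcoeff_mpol.
case: (boolP (perm_eq _ _)) => [/perm_sumn|_]; last by rewrite eqxx.
by rewrite sumn_nonzero => a_la _; rewrite [LHS]mdegEsumn.
Qed.

Lemma sf_homog_sfh k : sf_homog k (sfh k).
Proof.
move=> n; apply/dhomogP => a; rewrite mcoeff_msupp /= mcoeff_hpol.
by have [//|_] := eqVneq (mdeg a) k; rewrite eqxx.
Qed.

Lemma sf_homog_sfhpart la : sf_homog (psize la) (sfhpart la).
Proof.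
rewrite /sfhpart /psize; elim: (ipval la) => [|k s IH] /=.
  by move=> n; rewrite big_nil /=; apply: dhomog1.
by rewrite big_cons; apply/sf_homogM/IH/sf_homog_sfh.
Qed.

Lemma sfpol_sfhpart la n : sfhpart la n = \prod_(k <- la) hpol n k.
Proof. exact: (big_morph (fun f => f n)). Qed.

(** * The Hall form *)

(** Indexed by the finite list [r], the families are square matrices over a commutative ring, where
    a one-sided inverse is two-sided. *)
Lemma delta_inverseC (T : eqType) (r : seq T) (A B : T -> T -> int) : uniq r ->
  (forall x y, x \in r -> y \in r ->
     \sum_(z <- r) A x z * B z y = (x == y)%:R) ->
  forall x y, x \in r -> y \in r ->
     \sum_(z <- r) B x z * A z y = (x == y)%:R.
Proof.
move=> r_uniq AB; set t := in_tuple r.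
pose M (C : T -> T -> int) := \matrix_(i, j < size r) C (tnth t i) (tnth t j).
have MM (C D : T -> T -> int) i j :
    (M C *m M D) i j = \sum_(z <- r) C (tnth t i) z * D z (tnth t j).
  by rewrite mxE [RHS]big_tnth; apply: eq_bigr => k _; rewrite !mxE.
have tE (i j : 'I_(size r)) : (tnth t i == tnth t j) = (i == j).
  have x0 : T := tnth t i; apply/eqP/eqP => [|->//].
  rewrite !(tnth_nth x0) => /eqP.
  by rewrite nth_uniq // => /eqP/val_inj.
have BA : M B *m M A = 1%:M.
  apply: mulmx1C; apply/matrixP => i j; rewrite MM AB ?mem_tnth //.
  by rewrite !mxE tE.
move=> x y /(tnthP t)[i ->] /(tnthP t)[j ->].
by rewrite -MM BA !mxE tE.
Qed.

Section Hall.
Context (hall : symfun -> symfun -> int) (hallP : is_hall hall).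

Lemma hall_subl f1 f2 g : hall (f1 - f2) g = hall f1 g - hall f2 g.
Proof. by apply/eqP; rewrite eq_sym subr_eq -(hall_addl hallP) subrK. Qed.

Lemma hall_sumMzl (I : Type) (r : seq I) (F : I -> symfun) (c : I -> int) g :
  hall (\sum_(i <- r) F i *~ c i) g = \sum_(i <- r) hall (F i) g * c i.
Proof. exact: (morph_sumMz (phi := hall^~ g) _ _ _ (hall_addl hallP g)). Qed.

Lemma hall_sumMzr (I : Type) (r : seq I) (F : I -> symfun) (c : I -> int) f :
  hall f (\sum_(i <- r) F i *~ c i) = \sum_(i <- r) hall f (F i) * c i.
Proof. exact: (morph_sumMz (phi := hall f) _ _ _ (hall_addr hallP f)). Qed.

(** The support of [f] is finite because its degree is bounded; in the resulting expansion in the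
    m's, duality keeps one term. *)
Lemma hall_sfhpart la f : hall (sfhpart la) f = coef f la.
Proof.
have [D fD] := coef_large f.
have fr nu : coef f nu != 0 -> nu \in parts D by rewrite mem_parts; exact: fD.
rewrite {1}(sfm_expand (parts_uniq D) fr) hall_sumMzr.
under eq_bigr do rewrite (hall_dual hallP).
rewrite (@sum_delta _ _ (coef f)) ?parts_uniq //; case: ifP => // /negbT.
by apply: contraNeq => /eqP ?; apply: fr; apply/eqP; congruence.
Qed.

Lemma coef_sfhpart0 D la ka :
  la \in parts D -> ka \notin parts D -> coef (sfhpart la) ka = 0.
Proof.
rewrite !mem_parts => laD; apply: contraNeq.
by move/(sf_homog_coef (sf_homog_sfhpart la)) => ->.
Qed.

(* If N is the matrix of the h's in the m's and G the Gram matrix of the m's,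
   duality says N G = 1; hence G N = 1, that is, G expresses the m's in the
   h's. *)
Lemma sfm_hspan D la : la \in parts D ->
  sfm la = \sum_(nu <- parts D) sfhpart nu *~ hall (sfm la) (sfm nu).
Proof.
move=> laD; apply: eq_coef => ka; rewrite coef_sumMz coef_sfm.
have [kaD|kaD] := boolP (ka \in parts D); last first.
  rewrite big_seq big1 => [|nu nuD]; last by rewrite (coef_sfhpart0 nuD) ?mul0r.
  by case: eqP => // ka_la; rewrite ka_la laD in kaD.
under eq_bigr do rewrite mulrC.
rewrite eq_sym; apply/esym.
apply: (@delta_inverseC _ (parts D) (fun x y => coef (sfhpart x) y)
  (fun x y => hall (sfm x) (sfm y))) => //; first exact: parts_uniq.
move=> x y xD yD.
rewrite -(hall_dual hallP).
rewrite [in RHS](@sfm_expand (sfhpart x) (parts D)) ?parts_uniq //.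
  by rewrite hall_sumMzl; apply: eq_bigr => z _; rewrite mulrC.
by move=> z; apply: contraNT => zD; rewrite (coef_sfhpart0 xD).
Qed.

(** Each m_la in the expansion of [f] is rewritten in the h's, and the two sums are exchanged. Hence
    the h's span. *)
Lemma hspan_large f : exists D,
  f = \sum_(nu <- parts D) sfhpart nu *~ hall f (sfm nu).
Proof.
have [D fD] := coef_large f; exists D.
have def_f := sfm_expand (parts_uniq D)
  (fun la laf => etrans (mem_parts D la) (fD la laf)).
have hall_f nu : hall f (sfm nu) =
    \sum_(la <- parts D) hall (sfm la) (sfm nu) * coef f la.
  by rewrite {1}def_f hall_sumMzl.
under eq_bigr do rewrite hall_f mulrz_sumr.
rewrite exchange_big {1}def_f big_seq [RHS]big_seq.
apply: eq_bigr => la /sfm_hspan {1}->; rewrite mulrz_suml.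
by apply: eq_bigr => nu _; rewrite mulrzA.
Qed.

Lemma hall_inj f g : (forall nu, hall f (sfm nu) = hall g (sfm nu)) -> f = g.
Proof.
move=> fg; apply/eqP; rewrite -subr_eq0.
have [D ->] := hspan_large (f - g); apply/eqP/big1 => nu _.
by rewrite hall_subl fg subrr mulr0z.
Qed.

(** Here the list is at the user's choice, as long as it contains the support; both sides have the
    same pairings with the m's. *)
Lemma hspan f (r : seq intpart) : uniq r ->
  (forall nu, hall f (sfm nu) != 0 -> nu \in r) ->
  f = \sum_(nu <- r) sfhpart nu *~ hall f (sfm nu).
Proof.
move=> r_uniq fr; apply: hall_inj => nu; rewrite hall_sumMzl.
under eq_bigr do rewrite (hall_dual hallP) eq_sym.
rewrite (@sum_delta _ r (fun ka => hall f (sfm ka))) //.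
by case: ifP => // /negbT; apply: contraNeq; exact: fr.
Qed.

(** * Pairings of a skew complete function with the monomial functions *)

Section Skew.
Context (la mu : intpart) (n : nat) (u : symfun).
Context (uP : is_skew_complete hall la mu u).
Context (sz : psize la = (psize mu + n)%N).

Lemma skew_complete_hall nu : hall u (sfm nu) = coef (sfhpart mu * sfm nu) la.
Proof. by rewrite uP hall_sfhpart. Qed.

Lemma skew_complete_homog nu : hall u (sfm nu) != 0 -> psize nu = n.
Proof.
rewrite skew_complete_hall.
move/(sf_homog_coef (sf_homogM (sf_homog_sfhpart mu) (sf_homog_sfm nu))).
by rewrite sz => /addnI.
Qed.

End Skew.
End Hall.

(** * Contingency tables *)

Lemma mcoeffM_le (n : nat) (p q : {mpoly int[n]}) (a : 'X_{1..n}) :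
  (p * q)@_a =
  \sum_(b : 'X_{1..n < (mdeg a).+1} | (b <= a)%MM) p@_b * q@_(a - b).
Proof. exact: mcoeff_poly_mul_lin. Qed.

Lemma hprod_ge0 (n : nat) s (a : 'X_{1..n}) : 0 <= (\prod_(k <- s) hpol n k)@_a.
Proof.
elim: s a => [|k s IH] a; first by rewrite big_nil mcoeff1 ler0n.
rewrite big_cons mcoeffM_le; apply: sumr_ge0 => b _.
by rewrite mulr_ge0 // mcoeff_hpol ler0n.
Qed.

(** The vector is raised one unit at a time: while its degree is below that of [a], some coordinate
    still has room. *)
Lemma exists_mdeg (n k : nat) (a : 'X_{1..n}) : (k <= mdeg a)%N ->
  exists2 b : 'X_{1..n}, (b <= a)%MM & mdeg b = k.
Proof.
elim: k => [|k IH] ka.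
  by exists 0%MM; rewrite ?mdeg0 //; apply/mnm_lepP => i; rewrite mnm0E.
have [b ba bk] := IH (ltnW ka).
have [i lti] : exists i, (b i < a i)%N.
  apply/existsP; apply: contraLR ka; rewrite negb_exists -leqNgt => /forallP ab.
  by rewrite -bk !mdegE; apply: leq_sum => i _; rewrite leqNgt.
exists (b + U_(i))%MM; last by rewrite mdegD mdeg1 bk addn1.
apply/mnm_lepP => j; rewrite mnmDE mnm1E; case: eqVneq => [<-|_].
  by rewrite addn1.
by rewrite addn0; move/mnm_lepP: ba.
Qed.

Lemma mdeg_sub (n : nat) (a b : 'X_{1..n}) :
  (b <= a)%MM -> mdeg (a - b)%MM = (mdeg a - mdeg b)%N.
Proof. by move/submK => {2}<-; rewrite mdegD addnK. Qed.

(** A table is filled greedily: any first row of sum [k] that fits under the column sums leaves a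
    smaller problem of the same kind. All other terms are nonnegative. *)
Lemma hprod_ge1 (n : nat) s (a : 'X_{1..n}) :
  mdeg a = sumn s -> 1 <= (\prod_(k <- s) hpol n k)@_a.
Proof.
elim: s a => [|k s IH] a /=.
  by move/eqP; rewrite mdeg_eq0 => /eqP->; rewrite big_nil mcoeff1 eqxx.
move=> a_ks; have [b ba bk] : exists2 b : 'X_{1..n}, (b <= a)%MM & mdeg b = k.
  by apply: exists_mdeg; rewrite a_ks leq_addr.
have ltb : (mdeg b < (mdeg a).+1)%N by rewrite bk a_ks ltnS leq_addr.
rewrite big_cons mcoeffM_le (bigD1 (BMultinom ltb)) //=.
rewrite mcoeff_hpol bk eqxx mul1r -[X in X <= _]addr0 lerD ?IH //.
  by rewrite mdeg_sub // bk a_ks addKn.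
by apply: sumr_ge0 => c _; rewrite mulr_ge0 ?hprod_ge0 // mcoeff_hpol ler0n.
Qed.

(* Moving one unit of the first row of a contingency table from column [i] to
   column [j] gives a second table. *)
Lemma hprod_ge2 (n k : nat) s (a : 'X_{1..n}) (i j : 'I_n) :
  mdeg a = (k + sumn s)%N -> (0 < k)%N -> (0 < sumn s)%N ->
  i != j -> (0 < a i)%N -> (0 < a j)%N ->
  1 < (\prod_(k <- k :: s) hpol n k)@_a.
Proof.
move=> a_ks k0 s0 neq_ij ai aj.
have Uija : (U_(i) + U_(j) <= a)%MM.
  apply/mnm_lepP => l; rewrite mnmDE !mnm1E.
  case: (eqVneq i l) => [<-|_]; first by rewrite eq_sym (negPf neq_ij).
  by case: eqVneq => [<-|].
(* [b] is the part of the first row shared by the two tables. One unit is reserved in each of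
   columns [i] and [j], and since [sumn s] is positive there is room for the remaining [k.-1]
   units. *)
have [b ba bk] :
    exists2 b : 'X_{1..n}, (b <= a - (U_(i) + U_(j)))%MM & mdeg b = k.-1.
  by apply: exists_mdeg; rewrite mdeg_sub // mdegD !mdeg1 a_ks; lia.
have ble l : l \in [:: i; j] -> (b + U_(l) <= a)%MM.
  have nat_le (x y z t : nat) :
    (x <= z -> z <= t -> y <= t - z -> y + x <= t)%N by lia.
  move=> lij; apply/mnm_lepP => m.
  move/mnm_lepP/(_ m): ba; move/mnm_lepP/(_ m): Uija.
  rewrite !mnmBE !mnmDE !mnm1E => h1 h2.
  have : ((l == m) <= (i == m) + (j == m))%N.
    by move: lij; rewrite !inE => /orP[] /eqP ->; rewrite ?leq_addr ?leq_addl.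
  by move/nat_le; apply.
have bdeg l : mdeg (b + U_(l))%MM = k by rewrite mdegD mdeg1 bk addn1 prednK.
have blt l : (mdeg (b + U_(l))%MM < (mdeg a).+1)%N.
  by rewrite bdeg a_ks ltnS leq_addr.
have ge1 l : l \in [:: i; j] ->
    1 <= (hpol n k)@_(b + U_(l)) *
         (\prod_(k <- s) hpol n k)@_(a - (b + U_(l))).
  move=> lij; rewrite mcoeff_hpol bdeg eqxx mul1r hprod_ge1 //.
  by rewrite mdeg_sub ?ble // bdeg a_ks addKn.
rewrite big_cons mcoeffM_le (bigD1 (BMultinom (blt i))) ?ble ?inE ?eqxx //=.
rewrite (bigD1 (BMultinom (blt j))) /=; last first.
  rewrite ble ?inE ?eqxx ?orbT //= bmeqP /= eqm_add2l.
  apply: contraNneq neq_ij => /mnmP/(_ j)/eqP; rewrite !mnm1E eqxx.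
  by case: (i == j).
(* The shape mirrors the sum: two isolated terms, each at least 1, and a nonnegative rest. *)
apply: lt_le_trans (_ : 1 + (1 + 0) <= _); first by [].
rewrite !lerD ?ge1 ?inE ?eqxx ?orbT //.
by apply: sumr_ge0 => c _; rewrite mulr_ge0 ?hprod_ge0 // mcoeff_hpol ler0n.
Qed.

Lemma nonzero_mnmE (n : nat) (a : 'X_{1..n}) :
  nonzero a = [seq a i | i <- enum 'I_n & (0 < a i)%N].
Proof.
rewrite -[RHS](filter_map a (leq 1)) /nonzero; congr filter.
by rewrite -[LHS]map_tnth_enum.
Qed.

Lemma nonzero_mnm1 (n : nat) (i : 'I_n) (a : 'X_{1..n}) :
  (forall j, j != i -> a j = 0%N) -> nonzero a = nonzero [:: a i].
Proof.
move=> ai; rewrite nonzero_mnmE /=; have [a0|a0] := posnP (a i).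
  rewrite (@eq_filter _ _ pred0) ?filter_pred0 // => j.
  by have [->|/ai ->] := eqVneq j i; rewrite ?a0.
rewrite (@eq_filter _ _ (pred1 i)) => [|j] /=; last first.
  by have [->|/ai ->] := eqVneq j i.
by rewrite filter_pred1_uniq ?enum_uniq ?mem_enum.
Qed.

(* The coefficient does not change when the zero exponents are dropped, and in
   one variable each h_k is a power. *)
Lemma hprod_single (n : nat) mu (a : 'X_{1..n}) (i : 'I_n) :
  mdeg a = psize mu -> (forall j, j != i -> a j = 0%N) ->
  (\prod_(k <- mu) hpol n k)@_a = 1.
Proof.
move=> a_mu ai; rewrite -sfpol_sfhpart.
have aiE : a i = psize mu.
  by rewrite -a_mu mdegE (bigD1 i) //= big1 ?addn0.
pose b : 'X_{1..1} := [multinom psize mu | _ < 1].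
rewrite (@mcoeff_nonzero _ _ 1%N _ b); last first.
  rewrite (nonzero_mnm1 ai) aiE (@nonzero_mnm1 1 ord0) ?mnmE // => j.
  by rewrite ord1.
rewrite sfpol_sfhpart.
have hX k : hpol 1 k = 'X_ord0 ^+ k.
  apply/mpolyP => c; rewrite mcoeff_hpol mcoeffXn.
  congr _%:R; congr nat_of_bool.
  rewrite mdegE big_ord1; apply/eqP/eqP => [ck|<-]; last first.
    by rewrite mulmnE mnm1E eqxx mul1n.
  by apply/mnmP => j; rewrite (ord1 j) mulmnE mnm1E eqxx mul1n.
under eq_bigr do rewrite hX.
rewrite -expr_sum -sumnE mcoeffXn -/(psize mu).
apply/eqP; rewrite pnatr_eq1 eqb1; apply/eqP/mnmP => j.
by rewrite (ord1 j) mulmnE mnm1E eqxx mul1n mnmE.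
Qed.

(** A monomial with [k] as its only nonzero exponent is determined by its position. Positivity of
    [k] keeps the monomials for different [i] distinct. *)
Lemma mpol_power_sum (n : nat) (ka : intpart) (k : nat) :
  ka = [:: k] :> seq nat -> mpol n ka = \sum_(i < n) 'X_[U_(i) *+ k].
Proof.
move=> kaE; have k0 : (0 < k)%N.
  by apply: (@intpart_gt0 ka); rewrite kaE mem_head.
apply/mpolyP => a; rewrite mcoeff_mpol kaE raddf_sum /=.
under eq_bigr do rewrite mcoeffX.
have [/(perm_small_eq (s2 := [:: k]) isT)|ak] := boolP (perm_eq _ _).
  rewrite nonzero_mnmE; case E : (filter _ _) => [|i [|]] //= [aik].
  have Ei j : j != i -> a j = 0%N.
    move=> ji; apply/eqP; rewrite -leqn0 leqNgt; apply: contra ji => aj.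
    by rewrite -(mem_seq1 j i) -E mem_filter aj mem_enum.
  rewrite (bigD1 i) //= big1 ?addr0 => [|j /negPf ji].
    case: eqP => // [[]]; apply/mnmP => j; rewrite mulmnE mnm1E.
    by case: eqVneq => [<-|ij]; rewrite ?mul1n // Ei // eq_sym.
  apply/eqP; rewrite pnatr_eq0 eqb0; apply/eqP => /mnmP/(_ j)/eqP.
  by rewrite mulmnE mnm1E eqxx mul1n Ei ?ji // => /eqP k00; rewrite k00 in k0.
rewrite big1 // => i _; apply/eqP; rewrite pnatr_eq0 eqb0.
apply: contra ak => /eqP <-.
rewrite (@nonzero_mnm1 _ i) => [|j ji]; rewrite mulmnE mnm1E.
  by rewrite eqxx mul1n /= k0.
by rewrite eq_sym (negPf ji).
Qed.

Lemma mcoeffMXn (n : nat) (p : {mpoly int[n]}) (a b : 'X_{1..n}) :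
  (p * 'X_[b])@_a = if (b <= a)%MM then p@_(a - b) else 0.
Proof.
case: ifP => [/submK {1}<-|nba]; first by rewrite addmC mcoeffMX.
rewrite mcoeffM big1 // => -[c d] /= /eqP acd; rewrite mcoeffX.
case: eqP => [bd|_]; last by rewrite mulr0.
by rewrite acd bd lem_addl in nba.
Qed.

(** As m_(n) is the sum of the x_i^n, each [i] contributes the coefficient of h_mu at la - n e_i,
    when that vector exists. *)
Lemma coef_hm (la mu ka : intpart) (n : nat) : ka = [:: n] :> seq nat ->
  coef (sfhpart mu * sfm ka) la =
  \sum_(i < size la | (n <= nth 0 la i)%N)
     (\prod_(k <- mu) hpol (size la) k)@_(part_mnm la - U_(i) *+ n).
Proof.
move=> kaE; rewrite /coef /= (mpol_power_sum _ kaE) sfpol_sfhpart mulr_sumr.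
rewrite raddf_sum [RHS]big_mkcond; apply: eq_bigr => i _ /=.
rewrite mcoeffMXn; congr (if _ then _ else _).
apply/mnm_lepP/idP => [/(_ i)|ni j].
  by rewrite mulmnE mnm1E eqxx mul1n (mnm_nth 0%N).
rewrite mulmnE mnm1E; case: eqVneq => [<-|//].
by rewrite mul1n (mnm_nth 0%N).
Qed.

Lemma part_le la (i j : nat) : (i <= j)%N -> (part la j <= part la i)%N.
Proof.
move=> ij; case: (ltnP j (size la)) => jla; last by rewrite /part nth_default.
have /andP[la_sorted _] := ipvalP la.
apply: (sorted_leq_nth geq_trans _ 0%N la_sorted) => //.
  by move=> x; rewrite /geq /=.
exact: leq_ltn_trans jla.
Qed.

(** * When the coefficient of h_n in h_{la/mu} is 1 *)

Section RowRemoval.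
Context (la mu ka : intpart) (n : nat).
Context (n_gt0 : (0 < n)%N) (kaE : ka = [:: n] :> seq nat).
Context (sz : psize la = (psize mu + n)%N).

Let al (i : 'I_(size la)) := (part_mnm la - U_(i) *+ n)%MM.
Let N (i : 'I_(size la)) : int := (\prod_(k <- mu) hpol (size la) k)@_(al i).

Let alE (i j : 'I_(size la)) : al i j = (part la j - (i == j) * n)%N.
Proof. by rewrite /al mnmBE mulmnE mnm1E (mnm_nth 0%N). Qed.

Let mdeg_al (i : 'I_(size la)) : (n <= part la i)%N -> mdeg (al i) = psize mu.
Proof.
move=> ni; rewrite mdeg_sub; last first.
  apply/mnm_lepP => j; rewrite mulmnE mnm1E (mnm_nth 0%N).
  by case: eqVneq => [<-|//]; rewrite mul1n.
rewrite mdegMn mdeg1 mul1n.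
by rewrite mdegEsumn -[sumn _]/(psize la) sz addnK.
Qed.

Let N_ge1 (i : 'I_(size la)) : (n <= part la i)%N -> 1 <= N i.
Proof. by move=> ni; apply: hprod_ge1; rewrite mdeg_al. Qed.

Let coefE : coef (sfhpart mu * sfm ka) la =
  \sum_(i < size la | (n <= part la i)%N) N i.
Proof. exact: coef_hm. Qed.

Let coef_row0 (la0 : (0 < size la)%N) :
  (n <= part la 0)%N -> (part la 1 < n)%N ->
  coef (sfhpart mu * sfm ka) la = N (Ordinal la0).
Proof.
move=> n0 n1; rewrite coefE (big_pred1 (Ordinal la0)) // => i /=.
rewrite -val_eqE /=; case: (val i) => [|j]; first by rewrite n0.
by rewrite leqNgt (leq_ltn_trans _ n1) ?part_le.
Qed.

Lemma coef_hm_ge0 : 0 <= coef (sfhpart mu * sfm ka) la.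
Proof. by rewrite coefE sumr_ge0 // => i _; exact: hprod_ge0. Qed.

(** An empty sum would be 0, and two admissible rows would contribute at least 2. *)
Lemma coef_hm_rows : coef (sfhpart mu * sfm ka) la = 1 ->
  (n <= part la 0)%N /\ (part la 1 < n)%N.
Proof.
move=> c1.
have n0 : (n <= part la 0)%N.
  rewrite leqNgt; apply/negP => n0; have := oner_neq0 int.
  rewrite -c1 coefE big_pred0 ?eqxx // => i.
  by rewrite leqNgt (leq_ltn_trans (part_le _ (leq0n i))).
split=> //; rewrite ltnNge; apply/negP => n1.
have la1 : (1 < size la)%N.
  rewrite ltnNge; apply: contraL n1 => la_le1.
  by rewrite /part nth_default // -ltnNge.
suff : 1 < coef (sfhpart mu * sfm ka) la by rewrite c1.
rewrite coefE (bigD1 (Ordinal (ltnW la1))) //=.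
rewrite (bigD1 (Ordinal la1)) /=; last by rewrite n1.
apply: lt_le_trans (_ : 1 + (1 + 0) <= _); first by [].
rewrite !lerD ?N_ge1 //; apply: sumr_ge0 => i _; exact: hprod_ge0.
Qed.

(** Only the first row of [la] can be shortened, so a single table count must be 1. By [hprod_ge2]
    this leaves [mu] with at most one part, or at most one nonzero column. *)
Lemma coef_hm_eq1 : coef (sfhpart mu * sfm ka) la = 1 <->
  (n <= part la 0)%N /\
  [\/ (mu = nonzero [:: psize mu] :> seq nat) /\ (part la 1 < n)%N,
      (la = nonzero [:: n; psize mu] :> seq nat) /\ (psize mu < n)%N
    | la = nonzero [:: (n + psize mu)%N] :> seq nat].
Proof.
have la0 : (0 < size la)%N.
  by apply: size_intpart_gt0; rewrite sz addn_gt0 n_gt0 orbT.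
split=> [c1|[n0 cases]].
  have [n0 n1] := coef_hm_rows c1; split=> //.
  rewrite (coef_row0 la0) // in c1.
  case muE : (ipval mu) => [|k [|k' s]].
  - by apply: Or31; rewrite /psize muE.
  - apply: Or31; rewrite /psize muE /= addn0; split=> //.
    by rewrite (@intpart_gt0 mu) // muE mem_head.
  have mu_gt0 x : x \in [:: k, k' & s] -> (0 < x)%N.
    by rewrite -muE; apply: intpart_gt0.
  have N_le1 (i j : 'I_(size la)) :
      i != j -> (0 < al (Ordinal la0) i)%N -> al (Ordinal la0) j = 0%N.
    move=> ij ali; apply/eqP; rewrite -leqn0 leqNgt; apply/negP => alj.
    suff : 1 < N (Ordinal la0) by rewrite c1.
    rewrite /N muE; apply: (hprod_ge2 _ _ _ ij) => //.
    - by rewrite mdeg_al // /psize muE.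
    - by rewrite mu_gt0 // mem_head.
    - by rewrite /= addn_gt0 mu_gt0 // !inE eqxx orbT.
  have la_gt0 i : (i < size la)%N -> (0 < part la i)%N.
    by move=> ila; apply: (@intpart_gt0 la); rewrite mem_nth.
  (* Parts after the first are untouched and positive, so at most one exists. If it does, the first
     column must be emptied, which makes the first part equal to [n]. *)
  case laE : (ipval la) => [|x0 [|x1 [|x2 t]]].
  - by have := la0; rewrite laE.
  - apply: Or33; rewrite addnC -sz /psize laE /= addn0.
    by have := la_gt0 0%N la0; rewrite /part laE /= => ->.
  - have la1 : (1 < size la)%N by rewrite laE.
    have := N_le1 (Ordinal la1) (Ordinal la0) isT; rewrite !alE /= subn0 mul1n.
    move=> /(_ (la_gt0 1%N la1))/eqP; rewrite subn_eq0 => x0n.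
    have x0E : x0 = n.
      by apply/eqP; rewrite eqn_leq; move: n0 x0n; rewrite /part laE => -> ->.
    have x1E : x1 = psize mu.
      by apply/eqP; rewrite -(eqn_add2r n) -sz /psize laE /= addn0 x0E addnC.
    apply: Or32; move: (la_gt0 1%N la1) n1.
    by rewrite /part laE /= x0E -x1E n_gt0 => ->.
  - have la2 : (2 < size la)%N by rewrite laE.
    have := N_le1 (Ordinal (ltnW la2)) (Ordinal la2) isT.
    rewrite !alE /= !subn0 => /(_ (la_gt0 1%N (ltnW la2))) x20.
    by have := la_gt0 2%N la2; rewrite /= x20.
(* Each of the three conditions forces the second part below [n], so again only the first row
   contributes. *)
have n1 : (part la 1 < n)%N.
  case: cases => [[//]|[laE mun]|laE]; rewrite /part laE /=.
    by rewrite n_gt0 /=; case: ifP.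
  by rewrite addn_gt0 n_gt0.
rewrite (coef_row0 la0) //.
have row_only : part la 1 = 0%N -> N (Ordinal la0) = 1.
  move=> p1; apply: (@hprod_single _ _ _ (Ordinal la0)).
    exact: mdeg_al.
  move=> j; rewrite alE -!val_eqE /= -lt0n => j0; rewrite ltn_eqF // subn0.
  by apply/eqP; rewrite -leqn0 -p1 part_le.
case: cases => [[muE _]|[laE mun]|laE].
- have := mdeg_al (i := Ordinal la0) n0; rewrite /N muE /=.
  case: posnP => [->|_] a_mu; last by rewrite big_seq1 mcoeff_hpol a_mu eqxx.
  by rewrite big_nil mcoeff1 -mdeg_eq0 a_mu.
(* For empty [mu] the list (n, 0) loses its zero and [la] is a single row; otherwise the first
   column is emptied and all that remains lies in the second. *)
- have [mu0|mu0] := posnP (psize mu).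
    by apply: row_only; rewrite /part laE mu0 /= n_gt0.
  have {}laE : la = [:: n; psize mu] :> seq nat by rewrite laE /= n_gt0 mu0.
  have la1 : (1 < size la)%N by rewrite laE.
  apply: (@hprod_single _ _ _ (Ordinal la1)); rewrite ?mdeg_al // => j.
  have j2 : (j < 2)%N by rewrite -[2%N]/(size [:: n; psize mu]) -laE.
  rewrite alE -!val_eqE /= /part; case: (nat_of_ord j) j2 => [|[|]] //= _ _.
  by rewrite laE mul1n subnn.
- by apply: row_only; rewrite /part laE /= addn_gt0 n_gt0.
Qed.

End RowRemoval.

(** * Filtered spans and generators *)

Section FilteredSpan.
Context (A : comNzRingType).
Implicit Types v w : nat -> A.

(* The monomials in the [v k] are graded by giving [v k] the weight [k]; [v 0]
   does not occur. *)
Definition fspan v (D : nat) (x : A) : Prop :=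
  exists c : intpart -> int,
    x = \sum_(nu <- parts D) (\prod_(k <- nu) v k) *~ c nu.

Lemma fspan0 v D : fspan v D 0.
Proof. by exists (fun=> 0); rewrite big1. Qed.

Lemma fspanD v D x y : fspan v D x -> fspan v D y -> fspan v D (x + y).
Proof.
case=> [c ->] [d ->]; exists (fun nu => c nu + d nu); rewrite -big_split.
by apply: eq_bigr => nu _; rewrite mulrzDr.
Qed.

Lemma fspanMz v D x c : fspan v D x -> fspan v D (x *~ c).
Proof.
case=> [d ->]; exists (fun nu => d nu * c); rewrite mulrz_suml.
by apply: eq_bigr => nu _; rewrite mulrzA.
Qed.

Lemma fspan_sum v D (I : eqType) (r : seq I) (F : I -> A) :
  (forall i, i \in r -> fspan v D (F i)) -> fspan v D (\sum_(i <- r) F i).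
Proof.
move=> rF; rewrite big_seq; elim/big_rec: _ => [|i x /rF]; first exact: fspan0.
exact: fspanD.
Qed.

Lemma fspan_monomial v D s : all (leq 1) s -> (sumn s <= D)%N ->
  fspan v D (\prod_(k <- s) v k).
Proof.
move=> s0 sD; have [la las] : exists la, perm_eq la s.
  exists (intpart_of s).
  by rewrite -[X in perm_eq _ X](nonzero_id s0) perm_intpart_of.
exists (fun nu => (la == nu)%:R).
rewrite (bigD1_seq la) ?parts_uniq //=; last first.
  by rewrite mem_parts /psize (perm_sumn las).
rewrite eqxx mulr1z [X in _ + X]big1 ?addr0 => [|nu /negPf nula]; last first.
  by rewrite eq_sym nula mulr0z.
by rewrite (perm_big _ las).
Qed.

Lemma fspan_mono v D E x : (D <= E)%N -> fspan v D x -> fspan v E x.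
Proof.
move=> DE [c ->]; apply: fspan_sum => nu; rewrite mem_parts => nuD.
exact/fspanMz/fspan_monomial/(leq_trans nuD DE)/intpart_all.
Qed.

Lemma fspanM v D E x y : fspan v D x -> fspan v E y -> fspan v (D + E) (x * y).
Proof.
case=> [c ->] [d ->]; rewrite mulr_suml; apply: fspan_sum => nu.
rewrite mem_parts => nuD; rewrite mulr_sumr; apply: fspan_sum => ka.
rewrite mem_parts => kaE; rewrite mulrzAl mulrzAr -big_cat.
apply/fspanMz/fspanMz/fspan_monomial; last by rewrite sumn_cat leq_add.
by rewrite all_cat !intpart_all.
Qed.

Lemma leq_sumn k s : k \in s -> (k <= sumn s)%N.
Proof. by move/perm_to_rem/perm_sumn => ->; rewrite leq_addr. Qed.

Lemma fspan_prod v w s : (forall k, k \in s -> fspan v k (w k)) ->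
  fspan v (sumn s) (\prod_(k <- s) w k).
Proof.
elim: s => [|k s IH] sw /=.
  by have := @fspan_monomial v 0 [::] isT (leqnn 0); rewrite !big_nil.
rewrite big_cons; apply: fspanM; first by apply/sw/mem_head.
by apply: IH => j js; apply: sw; rewrite inE js orbT.
Qed.

Lemma poly_eval_monomial v (N : nat) s : all (fun k => k < N)%N s ->
  exists p : {mpoly int[N]}, \prod_(k <- s) v k = poly_eval v p.
Proof.
elim: s => [_|k s IH /= /andP[kN /IH[p ps]]].
  by exists 1; rewrite big_nil /poly_eval rmorph1.
exists ('X_(Ordinal kN) * p).
by rewrite big_cons ps /poly_eval rmorphM /= mmapX mmap1U.
Qed.

(** Parts up to [D] occur, and variables are numbered from 0, whence [D.+1] of them. *)
Lemma poly_eval_fspan v D x : fspan v D x ->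
  exists p : {mpoly int[D.+1]}, x = poly_eval v p.
Proof.
case=> c ->; rewrite big_seq; elim/big_rec: _ => [|nu y].
  by exists 0; rewrite /poly_eval rmorph0.
rewrite mem_parts => nuD [p ->].
have [|q ->] := @poly_eval_monomial v D.+1 nu.
  by apply/allP => k /leq_sumn knu; rewrite ltnS (leq_trans knu).
by exists (q *~ c nu + p); rewrite /poly_eval rmorphD rmorphMz.
Qed.

(** The values of polynomials lie in every subring containing the [v k]. Closure under subtraction
    gives 0 = 1 - 1, then sums and all integers. *)
Lemma poly_eval_ind v (P : A -> Prop) :
  P 1 -> (forall x y, P x -> P y -> P (x - y)) ->
  (forall x y, P x -> P y -> P (x * y)) -> (forall k, P (v k)) ->
  forall (N : nat) (p : {mpoly int[N]}), P (poly_eval v p).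
Proof.
move=> P1 PB PM Pv N p.
have P0 : P 0 by rewrite -(subrr 1); exact: PB.
have PD x y : P x -> P y -> P (x + y).
  by move=> Px Py; rewrite -[y]opprK -(sub0r y); apply/PB/PB.
have PXn x n : P x -> P (x ^+ n).
  by move=> Px; elim: n => [|n IH]; rewrite ?expr0 // exprS; exact: PM.
have Pz (z : int) : P z%:~R.
  elim/int_ind: z => [|n|n]; rewrite ?mulr0z //.
    by rewrite -addn1 PoszD intrD => Pn; exact: PD.
  by rewrite -addn1 PoszD opprD intrD => Pn; exact: PB.
rewrite /poly_eval /mmap; elim/big_rec: _ => // m x _; apply: PD.
apply: (PM _ _ (Pz _)); rewrite /mmap1; elim/big_rec: _ => // i y _.
exact/PM/PXn.
Qed.

End FilteredSpan.

Lemma sfhpart_of s :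
  all (leq 1) s -> sfhpart (intpart_of s) = \prod_(k <- s) sfh k.
Proof.
by move=> s0; rewrite /sfhpart (perm_big _ (perm_intpart_of s)) nonzero_id.
Qed.

Lemma intpart_of_row (n : nat) :
  (0 < n)%N -> intpart_of [:: n] = [:: n] :> seq nat.
Proof. by move=> n0; rewrite /= n0. Qed.

Lemma sfhpartM nu ka :
  sfhpart nu * sfhpart ka = sfhpart (intpart_of (nu ++ ka)).
Proof. by rewrite sfhpart_of ?all_cat ?intpart_all // big_cat. Qed.

(** The union of two partitions is a single row only if one is empty and the other is that row; both
    cannot be empty since [n] is positive. *)
Lemma intpart_of_cat_row nu ka (n : nat) : (0 < n)%N ->
  (intpart_of (nu ++ ka) == intpart_of [:: n])%:R =
  (nu == intpart_of [:: n])%:R * (ka == intpart_of [::])%:R +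
  (nu == intpart_of [::])%:R * (ka == intpart_of [:: n])%:R :> int.
Proof.
move=> n0; have nil_row : (intpart_of [::] == intpart_of [:: n]) = false.
  by rewrite -val_eqE /= n0.
have [->|nu0] := eqVneq nu (intpart_of [::]).
  have -> : intpart_of (intpart_of [::] ++ ka) = ka := intpart_of_id ka.
  by rewrite nil_row mul0r add0r mul1r.
have [->|ka0] := eqVneq ka (intpart_of [::]).
  by rewrite cats0 intpart_of_id nil_row mulr0 mulr1 addr0.
rewrite mulr0 mul0r addr0; case: eqP => //.
move/(congr1 (fun la : intpart => size la)).
rewrite (perm_size (perm_intpart_of _)) nonzero_id ?all_cat ?intpart_all //.
rewrite intpart_of_row // size_cat; move: nu0 ka0; rewrite -!val_eqE /=.
by case: (ipval nu) (ipval ka) => [|x s] [|y t] //=; rewrite addnS.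
Qed.

(** * Monomials in the generators as partitions *)

(** Variable [i] stands for the generator of index [i.+1], so its exponent becomes the multiplicity
    of the part [i.+1]. *)
Definition exp_seq (N : nat) (a : 'X_{1..N}) : seq nat :=
  flatten [seq nseq (a i) i.+1 | i <- enum 'I_N].

Definition exp_part (N : nat) (a : 'X_{1..N}) : intpart :=
  intpart_of (exp_seq a).

Lemma perm_exp_part N (a : 'X_{1..N}) : perm_eq (exp_part a) (exp_seq a).
Proof.
rewrite -[X in perm_eq _ X]nonzero_id ?perm_intpart_of //.
by apply/allP => k /flattenP[t /mapP[i _ ->]] /nseqP[->].
Qed.

Lemma exp_part_inj N : injective (@exp_part N).
Proof.
move=> a b ab; apply/mnmP => i.
have count_exp (c : 'X_{1..N}) : count_mem i.+1 (exp_part c) = c i.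
  rewrite (seq.permP (perm_exp_part c)) count_flatten -map_comp sumnE big_map.
  rewrite big_enum (bigD1 i) //= count_nseq /= eqxx mul1n.
  rewrite big1 ?addn0 // => j ji.
  by rewrite count_nseq /= eqSS (inj_eq val_inj) (negPf ji).
by rewrite -!count_exp ab.
Qed.

Lemma mmap1_exp_part (A : comNzRingType) (v : nat -> A) N (a : 'X_{1..N}) :
  mmap1 (fun i : 'I_N => v i.+1) a = \prod_(k <- exp_part a) v k.
Proof.
rewrite (perm_big _ (perm_exp_part a)) big_flatten big_map big_enum.
by apply: eq_bigr => i _; rewrite big_nseq iter_mulr_1.
Qed.

(** * The coefficient of h_n as a criterion for free generation *)

Section Hall.
Context (hall : symfun -> symfun -> int) (hallP : is_hall hall).

(* The power sum m_(n) is primitive, so pairing with it is a derivation over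
   the augmentation. *)
Lemma hall_row_mul (n : nat) f g : (0 < n)%N ->
  hall (f * g) (sfm (intpart_of [:: n])) =
  hall f (sfm (intpart_of [:: n])) * hall g (sfm (intpart_of [::])) +
  hall f (sfm (intpart_of [::])) * hall g (sfm (intpart_of [:: n])).
Proof.
move=> n0; set row := intpart_of [:: n]; set e := intpart_of [::].
have mulh nu : hall (sfhpart nu * g) (sfm row) =
    hall (sfhpart nu) (sfm row) * hall g (sfm e) +
    hall (sfhpart nu) (sfm e) * hall g (sfm row).
  have [E ->] := hspan_large hallP g.
  rewrite mulr_sumr; under eq_bigr do rewrite mulrzAr sfhpartM.
  rewrite !(hall_sumMzl hallP) !mulr_sumr -big_split; apply: eq_bigr => ka _.
  by rewrite !(hall_dual hallP) intpart_of_cat_row // mulrDl !mulrA.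
have [D ->] := hspan_large hallP f.
rewrite mulr_suml; under eq_bigr do rewrite mulrzAl.
rewrite !(hall_sumMzl hallP) !mulr_suml -big_split; apply: eq_bigr => nu _.
by rewrite mulh mulrDl !(mulrAC _ _ (hall g _)).
Qed.

Lemma hall_sfh_row (n : nat) :
  (0 < n)%N -> hall (sfh n) (sfm (intpart_of [:: n])) = 1.
Proof.
move=> n0; have -> : sfh n = sfhpart (intpart_of [:: n]).
  by rewrite sfhpart_of /= ?n0 // big_seq1.
by rewrite (hall_dual hallP) eqxx.
Qed.

Section Graded.
Context (u : nat -> symfun).
Context (u_homog : forall n nu, hall (u n) (sfm nu) != 0 -> psize nu = n).

Let rowc n := hall (u n) (sfm (intpart_of [:: n])).

(** By the derivation rule and homogeneity, [rowc n] divides the pairing of m_(n) with every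
    polynomial in the [u k]; the pairing with h_n is 1. *)
Lemma generates_row_dvd (n : nat) :
  (0 < n)%N -> alg_generates u -> (rowc n %| 1)%Z.
Proof.
move=> n0 /(_ (sfh n))[N [p sfhp]].
rewrite -[X in (_ %| X)%Z](hall_sfh_row n0) sfhp.
apply: (@poly_eval_ind _ u
  (fun f => rowc n %| hall f (sfm (intpart_of [:: n])))%Z).
- have -> : 1 = sfhpart (intpart_of [::]) by rewrite sfhpart_of // big_nil.
  by rewrite (hall_dual hallP) -val_eqE /= n0 dvdz0.
- by move=> f g fP gP; rewrite (hall_subl hallP) rpredB.
- move=> f g fP gP; rewrite hall_row_mul // rpredD //; first exact: dvdz_mulr.
  exact: dvdz_mull.
move=> k; have [->|kn] := eqVneq k n; first exact: dvdzz.
have -> : hall (u k) (sfm (intpart_of [:: n])) = 0; last exact: dvdz0.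
apply/eqP; apply: contraNT kn => /u_homog.
by rewrite psize_intpart_of /= addn0 => ->.
Qed.

Context (rowc1 : forall n, (0 < n)%N -> rowc n = 1).

(** The expansion of [u n] starts with h_n with coefficient 1. Solving for h_n leaves products of
    h_k with k < n, to which induction applies. *)
Lemma sfh_fspan n : (0 < n)%N -> fspan u n (sfh n).
Proof.
elim/ltn_ind: n => n IH n0; set row := intpart_of [:: n].
have /(hspan hallP (parts_uniq n)) u_exp : forall nu,
    hall (u n) (sfm nu) != 0 -> nu \in parts n.
  by move=> nu /u_homog <-; rewrite mem_parts.
have rown : row \in parts n by rewrite mem_parts psize_intpart_of /= addn0.
rewrite (bigD1_seq row) ?parts_uniq //= -/(rowc n) rowc1 // mulr1z in u_exp.
rewrite sfhpart_of /= ?n0 // big_seq1 in u_exp.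
move/eqP: u_exp; rewrite -subr_eq => /eqP <-.
apply: fspanD.
  by have := @fspan_monomial _ u n [:: n]; rewrite big_seq1 /= n0 addn0; apply.
rewrite -mulrN1z; apply: fspanMz; rewrite -big_filter; apply: fspan_sum => nu.
rewrite mem_filter mem_parts => /andP[nurow nun]; apply: fspanMz.
apply/(fspan_mono nun)/fspan_prod => k knu; apply: IH (intpart_gt0 knu).
rewrite ltn_neqAle (leq_trans (leq_sumn knu) nun) andbT.
(* A part equal to [n] in a partition of size at most [n] leaves no room for another, so the
   partition would be the excluded row. *)
apply: contraNneq nurow => kn; apply/eqP/esym/eq_intpart_of; rewrite -kn.
have nu_k := perm_to_rem knu; rewrite nonzero_id ?(intpart_gt0 knu) //=.
  move: nu_k nun; case E : (rem k nu) => [|x t] nu_k; first by rewrite perm_sym.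
  rewrite /psize (perm_sumn nu_k) /= -kn -[X in (_ <= X)%N]addn0 leq_add2l.
  have /mem_rem/intpart_gt0 x0 : x \in rem k nu by rewrite E mem_head.
  by rewrite leqNgt addn_gt0 x0.
by rewrite (intpart_gt0 knu).
Qed.

Lemma sfhpart_fspan D nu : nu \in parts D -> fspan u D (sfhpart nu).
Proof.
rewrite mem_parts => /fspan_mono; apply; apply: fspan_prod => k knu.
exact: sfh_fspan (intpart_gt0 knu).
Qed.

Lemma row1_generates : alg_generates u.
Proof.
move=> f; have [D f_exp] := hspan_large hallP f.
have [p fp] : exists p : {mpoly int[D.+1]}, f = poly_eval u p.
  apply: poly_eval_fspan; rewrite f_exp; apply: fspan_sum => nu nuD.
  exact/fspanMz/sfhpart_fspan.
by exists D.+1, p.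
Qed.

(* The u_nu span what the h_nu span, and the h_nu are independent by duality, so
   a square matrix again has a one-sided, hence two-sided, inverse. *)
Lemma row1_independent : alg_independent (fun n => u n.+1).
Proof.
move=> N p p0.
(* Any common bound on the sizes of the partitions in the support of [p] would do; the sum of the
   sizes is one. *)
pose D := (\sum_(a <- msupp p) psize (exp_part a))%N.
have expD a : a \in msupp p -> exp_part a \in parts D.
  by move=> ap; rewrite mem_parts /D (bigD1_seq a) //= leq_addr.
have /choice[B h_exp] : forall ka, exists c : intpart -> int, ka \in parts D ->
    sfhpart ka = \sum_(nu <- parts D) (\prod_(k <- nu) u k) *~ c nu.
  move=> ka; case: (boolP (ka \in parts D)) => [/sfhpart_fspan[c hc]|_].
    by exists c.
  by exists (fun=> 0).
pose C nu ka := hall (\prod_(k <- nu) u k) (sfm ka).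
have BC nu ka : nu \in parts D -> ka \in parts D ->
    \sum_(xi <- parts D) B nu xi * C xi ka = (nu == ka)%:R.
  move=> nuD kaD; rewrite -(hall_dual hallP) h_exp // (hall_sumMzl hallP).
  by apply: eq_bigr => xi _; rewrite mulrC.
have CB := delta_inverseC (parts_uniq D) BC.
(* Pairing the relation with m_ka says that the coefficient vector of [p] is killed by [C]. *)
have rel ka : \sum_(a <- msupp p) p@_a * C (exp_part a) ka = 0.
  have : hall (poly_eval (fun n => u n.+1) p) (sfm ka) = 0.
    by rewrite p0 -(subrr 0) (hall_subl hallP) subrr.
  rewrite /poly_eval /mmap.
  under eq_bigr do rewrite (mmap1_exp_part u) mulrzl.
  rewrite (hall_sumMzl hallP) => rel_ka.
  by under eq_bigr do rewrite mulrC.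
apply/mpolyP => a; rewrite mcoeff0.
have [ap|/memN_msupp_eq0 //] := boolP (a \in msupp p).
(* Multiplying by [B] on the right undoes [C] and isolates the coefficient at [a]. *)
transitivity (\sum_(ka <- parts D)
    (\sum_(b <- msupp p) p@_b * C (exp_part b) ka) * B ka (exp_part a)).
  under eq_bigr do rewrite mulr_suml.
  rewrite exchange_big /=.
  rewrite (bigD1_seq a) //= [X in _ + X]big1_seq => [|b /andP[ba bp]].
    under eq_bigr do rewrite -mulrA.
    by rewrite -mulr_sumr CB ?expD // eqxx mulr1 addr0.
  under eq_bigr do rewrite -mulrA.
  by rewrite -mulr_sumr CB ?expD // (inj_eq (@exp_part_inj N)) (negPf ba) mulr0.
by rewrite big1 // => ka _; rewrite rel mul0r.
Qed.

End Graded.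
End Hall.

End SkewComplete.

Theorem theorem3p9
    (hall : symfun -> symfun -> int) (hallP : is_hall hall)
    (la mu : nat -> intpart) (graded : graded_skew_sequence la mu)
    (u : nat -> symfun)
    (uP : forall n : nat, is_skew_complete hall (la n) (mu n) (u n)) :
  (alg_independent (fun n : nat => u n.+1) /\ alg_generates u) <->
  (forall n : nat, 1 <= n ->
     let m := psize (la n) - n in
     n <= part (la n) 0 /\
     [\/ (mu n = nonzero [:: m] :> seq nat) /\ part (la n) 1 < n,
         [/\ la n = nonzero [:: n; m] :> seq nat, m < n & psize (mu n) = m]
       | (la n = nonzero [:: n + m] :> seq nat) /\ psize (mu n) = m]).
Proof.
have u_homog n nu : (hall (u n) (sfm nu) != 0)%R -> psize nu = n.
  exact: (skew_complete_homog hallP (uP n) (graded n)).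
have row_one n : 1 <= n -> let m := psize (la n) - n in
    hall (u n) (sfm (intpart_of [:: n])) = 1%R <->
    n <= part (la n) 0 /\
    [\/ (mu n = nonzero [:: m] :> seq nat) /\ part (la n) 1 < n,
        [/\ la n = nonzero [:: n; m] :> seq nat, m < n & psize (mu n) = m]
      | (la n = nonzero [:: n + m] :> seq nat) /\ psize (mu n) = m].
  move=> n_gt0 m; have -> : m = psize (mu n) by rewrite /m graded addnK.
  rewrite (skew_complete_hall hallP (uP n)).
  rewrite (coef_hm_eq1 n_gt0 (intpart_of_row n_gt0) (graded n)).
  split=> -[n0 cases]; split=> //.
    case: cases => [?|[laE mun]|laE]; [exact: Or31 | | exact: Or33].
    by apply: Or32; split.
  case: cases => [?|[laE mun _]|[laE _]]; [exact: Or31 | | exact: Or33].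
  exact: Or32.
split=> [[_ gen] n n_gt0|cond].
  apply/(row_one n n_gt0).
  have := generates_row_dvd hallP u_homog n_gt0 gen.
  rewrite dvdz1 => /eqP abs1.
  (* A divisor of 1 is 1 or -1; being a number of tables, this one is not negative. *)
  have : (0 <= hall (u n) (sfm (intpart_of [:: n])))%R.
    rewrite (skew_complete_hall hallP (uP n)).
    exact: (coef_hm_ge0 (la n) (mu n) (intpart_of_row n_gt0)).
  by move/ssrint.gez0_abs; rewrite abs1.
have row1 n : 0 < n -> hall (u n) (sfm (intpart_of [:: n])) = 1%R.
  by move=> n_gt0; apply/(row_one n n_gt0)/cond.
split; first exact: (row1_independent hallP u_homog row1).
exact: (row1_generates hallP u_homog row1).
Qed.
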